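(* Under the hypotheses that $\sigma\in C^2(\mathbb{R})$ and that $\theta=\theta(\xi)$ is a twice differentiable reparametrization, for all indices $i,j,k,l$ of $\xi$: $$[\mathrm{Cov}(\hat{\mathcal{I}}_1(\xi))]^{ijkl}=\frac{\partial\theta_a}{\partial\xi_i}\frac{\partial\theta_b}{\partial\xi_j}\frac{\partial\theta_c}{\partial\xi_k}\frac{\partial\theta_d}{\partial\xi_l}[\mathrm{Cov}(\hat{\mathcal{I}}_1(\theta))]^{abcd},$$ $$[\mathrm{Cov}(\hat{\mathcal{I}}_2(\xi))]^{ijkl}=\frac{\partial\theta_a}{\partial\xi_i}\frac{\partial\theta_b}{\partial\xi_j}\frac{\partial\theta_c}{\partial\xi_k}\frac{\partial\theta_d}{\partial\xi_l}[\mathrm{Cov}(\hat{\mathcal{I}}_2(\theta))]^{abcd}+\frac1N\,\mathcal{C}^{\alpha\beta}_{ijkl}\,\mathcal{I}_{\alpha\beta}(h_L),$$ where $$\mathcal{C}^{\alpha\beta}_{ijkl}=\frac{\partial\theta_a}{\partial\xi_i}\frac{\partial\theta_b}{\partial\xi_j}\frac{\partial^2\theta_c}{\partial\xi_k\partial\xi_l}\partial_a\partial_bh_L^\alpha\,\partial_ch_L^\beta+\frac{\partial^2\theta_a}{\partial\xi_i\partial\xi_j}\frac{\partial\theta_b}{\partial\xi_k}\frac{\partial\theta_c}{\partial\xi_l}\partial_ah_L^\alpha\,\partial_b\partial_ch_L^\beta+\frac{\partial^2\theta_a}{\partial\xi_i\partial\xi_j}\frac{\partial^2\theta_b}{\partial\xi_k\partial\xi_l}\partial_ah_L^\alpha\,\partial_bh_L^\beta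 .$$
   Context: Setup. Fix an input $x\in\mathbb{R}^{n_0}$ and integers $L\ge1$, $n_1,\dots,n_L\ge1$. Network. The parameters are $\theta=(W_0,\dots,W_{L-1})$, with $W_l\in\mathbb{R}^{n_{l+1}\times(n_l+1)}$, viewed as a vector in $\mathbb{R}^{\dim\theta}$. Let $\sigma$ be applied entrywise. Set $h_0=x$ and $\bar h_l=(h_l^\top,1)^\top$. For $1\le l\le L-1$ let $h_l=\sigma(W_{l-1}\bar h_{l-1})$, and let $h_L=W_{L-1}\bar h_{L-1}\in\mathbb{R}^{n_L}$. Exponential family. The model is $p(y\mid x,\theta)=\exp(t(y)^\top h_L-F(h_L))$ with respect to a base measure $\nu$, where $t(y)\in\mathbb{R}^{n_L}$ and $F(h)=\log\int\exp(t(y)^\top h)\,d\nu(y)$. Assume $h_L$ lies in the interior of the natural parameter space. Let $\mathcal{I}(h_L)=\nabla^2F(h_L)=\mathrm{Cov}(t(y))$, with $y\sim p(y\mid x,\theta)$. Estimators. For a parameter vector $\phi$ (either $\theta$ or $\xi$) and i.i.d. samples $y_1,\dots,y_N\sim p(y\mid x,\theta)$ with $\ell_i=\log p(y_i\mid x,\theta)$, define $\hat{\mathcal{I}}_1(\phi)=\frac1N\sum_i\frac{\partial\ell_i}{\partial\phi}\frac{\partial\ell_i}{\partial\phi^\top}$ and $\hat{\mathcal{I}}_2(\phi)=\frac1N\sum_i(-\frac{\partial^2\ell_i}{\partial\phi\partial\phi^\top})$. The estimators in both coordinate systems use the same samples. Notation. $[\mathrm{Cov}(\hat{\mathcal{I}}(\phi))]^{ijkl}=\mathrm{Cov}(\hat{\mathcal{I}}^{ij}(\phi),\hat{\mathcal{I}}^{kl}(\phi))$.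 $\partial_a=\partial/\partial\theta_a$. Repeated indices $a,b,c,d$ and $\alpha,\beta$ are summed. *)

(* Defs.v *)
From HB Require Import structures.
From mathcomp Require Import all_boot all_order all_algebra.
From mathcomp Require Import all_classical all_reals all_analysis.
Set Implicit Arguments. Unset Strict Implicit. Unset Printing Implicit Defensive.
Import Order.TTheory GRing.Theory Num.Theory.
Import numFieldNormedType.Exports.
Local Open Scope classical_set_scope.
Local Open Scope ring_scope.

Section Defs.
Variable R : realType.

Definition ebasis (m : nat) (i : 'I_m) : 'rV[R]_m := delta_mx 0 i.

Definition partial (m : nat) (f : 'rV[R]_m -> R) (i : 'I_m) (phi : 'rV[R]_m) : R :=
  'D_(ebasis i) f phi.

Definition partial2 (m : nat) (f : 'rV[R]_m -> R) (i j : 'I_m) (phi : 'rV[R]_m) : R :=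
  partial (fun psi => partial f j psi) i phi.

Definition vlook (D : nat) (v : 'rV[R]_D) (k : nat) : R :=
  match (insub k : option 'I_D) with Some k' => v 0 k' | None => 0 end.

(** The network. n : nat -> nat gives the widths n_0, ..., n_L.
    W_l is an n_{l+1} x (n_l + 1) matrix; theta is the vector in R^{dim theta}
    obtained by concatenating W_0, ..., W_{L-1}, each stored row-major. *)
Definition woffset (n : nat -> nat) (l : nat) : nat :=
  (\sum_(k < l) n k.+1 * (n k).+1)%N.

Definition dimtheta (n : nat -> nat) (L : nat) : nat := woffset n L.

Definition weight (n : nat -> nat) (L : nat) (theta : 'rV[R]_(dimtheta n L))
  (l i j : nat) : R :=
  if [&& (l < L)%N, (i < n l.+1)%N & (j < (n l).+1)%N] then
    vlook theta (woffset n l + i * (n l).+1 + j)%N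
  else 0.

(* layer theta k i = i-th coordinate of h_k; bar h_k appends a 1 at index n_k;
   h_{k+1} = sigma(W_k bar h_k) for k+1 < L and h_L = W_{L-1} bar h_{L-1}. *)
Fixpoint layer (n : nat -> nat) (L : nat) (sigma : R -> R) (x : 'rV[R]_(n 0%N))
  (theta : 'rV[R]_(dimtheta n L)) (k : nat) (i : nat) : R :=
  match k with
  | 0%N => vlook x i
  | k'.+1 =>
      let z := \sum_(j < (n k').+1)
                 weight theta k' i j *
                 (if (j < n k')%N then layer sigma x theta k' j else 1) in
      if (k'.+1 < L)%N then sigma z else z
  end.

Definition hL (n : nat -> nat) (L : nat) (sigma : R -> R) (x : 'rV[R]_(n 0%N))
  (theta : 'rV[R]_(dimtheta n L)) : 'rV[R]_(n L) :=
  \row_(a < n L) layer sigma x theta L a.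

Section ExpFam.
Context {dY : measure_display} {Y : measurableType dY}.
Variables (q : nat) (nu : {measure set Y -> \bar R}) (t : Y -> 'rV[R]_q).

Definition dotp (u v : 'rV[R]_q) : R := \sum_(a < q) u 0 a * v 0 a.

Definition partfun (h : 'rV[R]_q) : \bar R :=
  (\int[nu]_y (expR (dotp (t y) h))%:E)%E.

Definition natparam : set 'rV[R]_q := [set h | (partfun h < +oo)%E].

Definition logpart (h : 'rV[R]_q) : R := ln (fine (partfun h)).

Definition expdens (h : 'rV[R]_q) (y : Y) : R := expR (dotp (t y) h - logpart h).

Definition Emodel (h : 'rV[R]_q) (f : Y -> R) : \bar R :=
  (\int[nu]_y (f y * expdens h y)%:E)%E.

Definition fisherI (h : 'rV[R]_q) (a b : 'I_q) : \bar R :=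
  Emodel h (fun y => (t y 0 a - fine (Emodel h (fun z => t z 0 a))) *
                     (t y 0 b - fine (Emodel h (fun z => t z 0 b)))).

Definition loglik (y : Y) (h : 'rV[R]_q) : R := dotp (t y) h - logpart h.
End ExpFam.

Section Estimators.
Context {dO : measure_display} {Omega : measurableType dO}.
Context {Y : Type}.
Variables (N : nat) (Ys : 'I_N -> Omega -> Y).

Definition Ihat1 (m : nat) (ell : Y -> 'rV[R]_m -> R) (phi : 'rV[R]_m)
  (i j : 'I_m) : Omega -> R :=
  fun w => N%:R^-1 * \sum_(s < N) partial (ell (Ys s w)) i phi * partial (ell (Ys s w)) j phi.

Definition Ihat2 (m : nat) (ell : Y -> 'rV[R]_m -> R) (phi : 'rV[R]_m)
  (i j : 'I_m) : Omega -> R :=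
  fun w => N%:R^-1 * \sum_(s < N) - partial2 (ell (Ys s w)) i j phi.
End Estimators.

Definition mutually_independent {dO : measure_display} {Omega : measurableType dO}
  {dY : measure_display} {Y : measurableType dY}
  (P : probability Omega R) (N : nat) (Ys : 'I_N -> Omega -> Y) : Prop :=
  forall A : 'I_N -> set Y, (forall s, measurable (A s)) ->
    P (\bigcap_(s in [set: 'I_N]) (Ys s @^-1` A s)) =
    (\prod_(s < N) P (Ys s @^-1` A s))%E.

End Defs.

(* Main.v *)
(** The log-likelihood is affine in the sufficient statistic [t], so both
    estimators are empirical means of polynomials in [t], and the chain rule
    expresses those in the coordinates [xi] through those in the coordinates
    [theta].  The first derivatives transform linearly, which gives the first
    identity by bilinearity of the covariance alone.  The second derivatives
    pick up the extra term [d2 theta/dxi dxi * d l/d theta]; up to additive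
    constants everything is then a linear combination of the means of the
    coordinates of [t], whose covariance is the Fisher information divided by
    [N] by independence, and expanding the product gives the second identity.

    The analytic input is that an interior point [h0] of the natural parameter
    space has [int exp (d |t|_1 + t . h0) d nu < oo] for some [d > 0].  This
    dominates all moments of [t], and also the second order Taylor remainder of
    [h |-> int phi exp (t . h) d nu], so that the log-partition function is
    twice differentiable at [h0] without any limit theorem. *)

Require Import Defs.
From HB Require Import structures.
From mathcomp Require Import all_boot all_order all_algebra.
From mathcomp Require Import ring lra.
From mathcomp Require Import all_classical all_reals all_analysis measurable_realfun.
Import Order.TTheory GRing.Theory Num.Theory.
Import numFieldNormedType.Exports.
Local Open Scope classical_set_scope.
Local Open Scope ring_scope.

(** * Differential calculus of functions of row vectors, up to second order *)

Section differential_calculus.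
Context {R : realType}.

(** Turns differentiability into an explicit remainder estimate, the form in which it is checked for
    moments below. *)
Lemma is_diff_near {V W : normedModType R} (f : V -> W) (df : {linear V -> W}) x :
  continuous df ->
  (forall e, 0 < e ->
     \forall h \near (0 : V), `|f (h + x) - f x - df h| <= e * `|h|) ->
  is_diff x f df.
Proof.
move=> dfc fe.
have dxf : f \o shift x = cst (f x) + df +o_ (0 : V) id.
  apply/eqaddoP => e e0; near=> h.
  by rewrite !fctE opprD addrA; near: h; exact: fe.
have dE := diff_unique dfc dxf.
by apply: DiffDef => //; apply/diff_locallyP; rewrite dE.
Unshelve. all: by end_near. Qed.

Lemma differentiable_near {V W : normedModType R} (f : V -> W) x :
  differentiable f x -> forall e, 0 < e ->
  \forall h \near (0 : V), `|f (h + x) - f x - 'd f x h| <= e * `|h|.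
Proof.
move=> /diff_locally/eqaddoP df e e0; near=> h.
have : `|(f \o shift x - (cst (f x) + 'd f x)) h| <= e * `|h|.
  by near: h; exact: df.
by rewrite !fctE opprD addrA.
Unshelve. all: by end_near. Qed.

(** The remainder estimate at [x] only sees values near [x]. This allows a partial derivative to be
    replaced by a formula valid only locally. *)
Lemma near_eq_differentiable {V W : normedModType R} (f g : V -> W) x :
  {near x, f =1 g} -> differentiable f x -> differentiable g x.
Proof.
move=> fg df.
suff : is_diff x g ('d f x) by move=> [].
apply: is_diff_near; first exact: diff_continuous.
move=> e e0; have fg0 : \forall h \near (0 : V), f (h + x) = g (h + x).
  rewrite (near_shift x)/=; near=> y; rewrite /= sub0r addrNK.
  near: y; exact: fg.
near=> h.
rewrite -(nbhs_singleton fg) -(near fg0 h)//; near: h.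
exact: differentiable_near.
Unshelve. all: by end_near. Qed.

Lemma linear_rV_sum {W : lmodType R} {m} (f : {linear 'rV[R]_m -> W}) v :
  f v = \sum_(a < m) v 0 a *: f (ebasis R a).
Proof.
rewrite {1}(row_sum_delta v) linear_sum; apply: eq_bigr => a _.
by rewrite linearZ.
Qed.

Lemma differentiable_rV {V : normedModType R} {m} (f : V -> 'rV[R]_m) x :
  (forall a, differentiable (fun y => f y 0 a) x) -> differentiable f x.
Proof.
move=> df.
rewrite (_ : f = \sum_(a < m) (fun y => f y 0 a *: ebasis R a)).
  by apply: differentiable_sum => a; exact: differentiableZl.
by apply/funext => y; rewrite fct_sumE; exact: row_sum_delta.
Qed.

Lemma differentiable_rV_coord {V : normedModType R} {m} (f : V -> 'rV[R]_m) x a :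
  differentiable f x -> differentiable (fun y => f y 0 a) x.
Proof.
move=> df; rewrite (_ : (fun _ => _) = (fun N : 'rV[R]_m => N 0 a) \o f)//.
apply: differentiable_comp => //; exact: differentiable_coord.
Qed.

Lemma derive_rV_coord {V : normedModType R} {m} (f : V -> 'rV[R]_m) x v a :
  derivable f x v -> 'D_v (fun y => f y 0 a) x = ('D_v f x) 0 a.
Proof. by move=> df; rewrite derive_mx// mxE. Qed.

Lemma derive_comp_rV {V : normedModType R} {m} (g : 'rV[R]_m -> R)
    (f : V -> 'rV[R]_m) x v :
  differentiable f x -> differentiable g (f x) ->
  'D_v (g \o f) x =
    \sum_(a < m) partial g a (f x) * 'D_v (fun y => f y 0 a) x.
Proof.
move=> df dg; rewrite deriveE; last exact: differentiable_comp.
rewrite diff_comp//= linear_rV_sum; apply: eq_bigr => a _.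
rewrite derive_rV_coord; last exact: diff_derivable.
by rewrite /partial !deriveE // mulrC.
Qed.


(** A condition at one point: [g] is differentiable on a neighbourhood, so that its partials are
    meaningful there, and these are Fréchet differentiable at [x] itself. Unlike a global condition,
    it can be imposed on the log-partition function at an interior point. *)
Definition twice_differentiable {m} (g : 'rV[R]_m -> R) (x : 'rV[R]_m) :=
  (\forall y \near x, differentiable g y) /\
  (forall a, differentiable (partial g a) x).

Lemma near_twice_differentiable {m} (g : 'rV[R]_m -> R)
    (dg : 'I_m -> 'rV[R]_m -> R) x :
  (\forall y \near x, differentiable g y) ->
  (forall a, \forall y \near x, dg a y = partial g a y) ->
  (forall a, differentiable (dg a) x) -> twice_differentiable g x.
Proof.
by move=> g1 g2 g3; split=> // a; exact: near_eq_differentiable (g2 a) (g3 a).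
Qed.

Lemma differentiable_sumf {V W : normedModType R} {m} (f : 'I_m -> V -> W) x :
  (forall i, differentiable (f i) x) ->
  differentiable (fun y => \sum_(i < m) f i y) x.
Proof.
move=> df; rewrite (_ : (fun _ => _) = \sum_(i < m) f i).
  exact: differentiable_sum.
by apply/funext => y; rewrite fct_sumE.
Qed.

Lemma derive_sumf {V : normedModType R} {m} (f : 'I_m -> V -> R) x v :
  (forall i, derivable (f i) x v) ->
  'D_v (fun y => \sum_(i < m) f i y) x = \sum_(i < m) 'D_v (f i) x.
Proof.
move=> df; rewrite (_ : (fun _ => _) = \sum_(i < m) f i).
  exact: derive_sum.
by apply/funext => y; rewrite fct_sumE.
Qed.

Lemma twice_differentiable_cst {m} (c : R) (x : 'rV[R]_m) :
  twice_differentiable (fun=> c) x.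
Proof.
apply: (@near_twice_differentiable _ _ (fun _ _ => 0)).
- by near=> y; exact: differentiable_cst.
- by move=> a; near=> y; rewrite /partial derive_cst.
- by move=> a; exact: differentiable_cst.
Unshelve. all: by end_near. Qed.

Lemma twice_differentiableM {m} (f g : 'rV[R]_m -> R) x :
  twice_differentiable f x -> twice_differentiable g x ->
  twice_differentiable (fun y => f y * g y) x.
Proof.
move=> [f1 f2] [g1 g2]; have fx := nbhs_singleton f1; have gx := nbhs_singleton g1.
apply: (@near_twice_differentiable _ _
  (fun a y => f y * partial g a y + g y * partial f a y)).
- by near=> y; apply: differentiableM; near: y.
- move=> a; near=> y; rewrite /partial.
  rewrite (@deriveM _ _ f g)//; apply: diff_derivable; near: y => //.
- by move=> a; apply: differentiableD; apply: differentiableM.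
Unshelve. all: by end_near. Qed.

Lemma twice_differentiable_sum {m q} (f : 'I_q -> 'rV[R]_m -> R) x :
  (forall i, twice_differentiable (f i) x) ->
  twice_differentiable (fun y => \sum_(i < q) f i y) x.
Proof.
move=> ft; have f1 : \forall y \near x, forall i, differentiable (f i) y.
  by apply: (@filter_forall _ _ _ (nbhs x) (nbhs_filter x)) => i; have [] := ft i.
apply: (@near_twice_differentiable _ _ (fun a y => \sum_(i < q) partial (f i) a y)).
- by near=> y; apply: (@differentiable_sumf _ _ _ f); near: y.
- move=> a; near=> y; rewrite /partial (@derive_sumf _ _ f)// => i.
  by apply: diff_derivable; move: i; near: y.
- move=> a; apply: (@differentiable_sumf _ _ _ (fun i => partial (f i) a)) => i.
  by have [] := ft i.
Unshelve. all: by end_near. Qed.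

Lemma twice_differentiable_coord {m} (a : 'I_m) (x : 'rV[R]_m) :
  twice_differentiable (fun y => y 0 a) x.
Proof.
apply: (@near_twice_differentiable _ _ (fun b _ => ebasis R b 0 a)).
- by near=> y; exact: differentiable_coord.
- move=> b; near=> y; rewrite /partial.
  by rewrite (@derive_rV_coord _ _ id) ?derive_id//.
- by move=> b; exact: differentiable_cst.
Unshelve. all: by end_near. Qed.

(** The assumptions on [s] are local at [f x] so that the lemma covers [ln] at a positive value as
    well as the activation. *)
Lemma twice_differentiable_comp1 {m} (s : R -> R) (f : 'rV[R]_m -> R) x :
  (\forall z \near f x, derivable s z 1) -> derivable (derive1 s) (f x) 1 ->
  twice_differentiable f x -> twice_differentiable (s \o f) x.
Proof.
move=> s1 /derivable1_diffP s2 [f1 f2]; have fx := nbhs_singleton f1.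
have s1f : \forall y \near x, differentiable s (f y).
  have /(_ _ s1) := differentiable_continuous fx.
  by apply: (@filterS _ _ (nbhs_filter x)) => y /= /derivable1_diffP.
apply: (@near_twice_differentiable _ _ (fun a y => (derive1 s) (f y) * partial f a y)).
- by near=> y; apply: differentiable_comp; near: y.
- move=> a; near=> y; rewrite /partial.
  have df : differentiable f y by near: y.
  have ds : differentiable s (f y) by near: y.
  rewrite [RHS]deriveE; last exact: differentiable_comp.
  rewrite diff_comp//= deriveE// diff1E// mulrC; exact: erefl.
- move=> a; apply: differentiableM => //.
  exact: (@differentiable_comp _ _ _ _ f (derive1 s)).
Unshelve. all: by end_near. Qed.

Section second_order_chain_rule.
Variables (m q : nat) (g : 'rV[R]_q -> R) (f : 'rV[R]_m -> 'rV[R]_q).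
Variable x : 'rV[R]_m.
Hypothesis gt : twice_differentiable g (f x).
Hypothesis ft : forall a, twice_differentiable (fun y => f y 0 a) x.

Let df : \forall y \near x, differentiable f y.
Proof.
have f1 : \forall y \near x, forall i, differentiable (fun y => f y 0 i) y.
  by apply: (@filter_forall _ _ _ (nbhs x) (nbhs_filter x)) => i; have [] := ft i.
by near=> y; apply: differentiable_rV; near: y.
Unshelve. all: by end_near. Qed.

Let dg : \forall y \near x, differentiable g (f y).
Proof.
have [g1 _] := gt.
exact: (differentiable_continuous (nbhs_singleton df) g1).
Qed.

Lemma near_partial_comp j : \forall y \near x, partial (g \o f) j y =
  \sum_(a < q) partial g a (f y) * partial (fun y => f y 0 a) j y.
Proof.
by near=> y; rewrite /partial derive_comp_rV//; near: y.
Unshelve. all: by end_near. Qed.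

(** The first order formula holds on a neighbourhood, hence may be differentiated again: the product
    rule gives two sums, and the chain rule applied to [partial g b \o f] turns one of them into the
    Hessian term. *)
Lemma partial2_comp i j : partial2 (g \o f) i j x =
  \sum_a \sum_b partial2 g a b (f x) *
     partial (fun y => f y 0 a) i x * partial (fun y => f y 0 b) j x
  + \sum_b partial g b (f x) * partial2 (fun y => f y 0 b) i j x.
Proof.
have fx := nbhs_singleton df.
have dgf b : differentiable (partial g b \o f) x.
  by apply: differentiable_comp => //; case: gt.
have dfb b k : differentiable (partial (fun y => f y 0 b) k) x by case: (ft b).
rewrite /partial2 {1}/partial (near_eq_derive _ (near_partial_comp j)).
rewrite (@derive_sumf _ _ (fun a y =>
    partial g a (f y) * partial (fun y => f y 0 a) j y)); last first.
  move=> b; apply: diff_derivable; apply: differentiableM => //; exact: dgf.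
(* The index [b] of the inner derivative of [g] becomes the outer summation index, to match the sum
   just differentiated. *)
rewrite [X in _ = X + _]exchange_big -big_split/=; apply: eq_bigr => b _.
rewrite (@deriveM _ _ (partial g b \o f) (partial (fun y => f y 0 b) j));
  [|exact: diff_derivable..].
rewrite [LHS]addrC derive_comp_rV//; last by case: gt.
by congr (_ + _); rewrite -mulr_suml; exact: mulrC.
Qed.

Lemma twice_differentiable_comp : twice_differentiable (g \o f) x.
Proof.
have fx := nbhs_singleton df.
apply: near_twice_differentiable.
- by near=> y; apply: differentiable_comp; near: y.
- by move=> j; near=> y; apply/esym; near: y; exact: near_partial_comp.
- move=> j; apply: (@differentiable_sumf _ _ _ (fun a y =>
    partial g a (f y) * partial (fun y => f y 0 a) j y)) => a; apply: differentiableM.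
    by apply: differentiable_comp => //; case: gt.
  by case: (ft a).
Unshelve. all: by end_near. Qed.

End second_order_chain_rule.

End differential_calculus.

(** * Smoothness of the network output in its weights *)

Section network.
Context {R : realType}.
Variables (n : nat -> nat) (L : nat) (sigma : R -> R) (x : 'rV[R]_(n 0%N)).
Hypothesis sigma1 : forall z, derivable sigma z 1.
Hypothesis sigma2 : forall z, derivable (derive1 sigma) z 1.
Implicit Type th : 'rV[R]_(dimtheta n L).

Lemma twice_differentiable_weight l i j th :
  twice_differentiable (fun th => weight th l i j) th.
Proof.
rewrite /weight; case: [&& _, _ & _]; last exact: twice_differentiable_cst.
rewrite /vlook; case: (insub _ : option 'I_(dimtheta n L)) => [a|];
  last exact: twice_differentiable_cst.
exact: twice_differentiable_coord.
Qed.

(** By induction on the layer: a preactivation is a sum of products of weights, which are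
    coordinates or constants, and outputs of the previous layer. *)
Lemma twice_differentiable_layer k i th :
  twice_differentiable (fun th => layer sigma x th k i) th.
Proof.
elim: k i => [|k IH] i /=; first exact: twice_differentiable_cst.
have zt : twice_differentiable (fun th : 'rV[R]_(dimtheta n L) =>
    \sum_(j < (n k).+1) weight th k i j *
      (if (j < n k)%N then layer sigma x th k j else 1)) th.
  apply: (@twice_differentiable_sum _ _ _ (fun (j : 'I__) th => weight th k i j *
      (if (j < n k)%N then layer sigma x th k j else 1))) => j.
  apply: twice_differentiableM; first exact: twice_differentiable_weight.
  by case: (j < n k)%N; [exact: IH|exact: twice_differentiable_cst].
case: (k.+1 < L)%N => //.
apply: (@twice_differentiable_comp1 _ _ sigma _ th _ _ zt) => //.
by near=> z.
Unshelve. all: by end_near. Qed.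

Lemma twice_differentiable_hL th al :
  twice_differentiable (fun th => hL sigma x th 0 al) th.
Proof.
rewrite (_ : (fun _ => _) = (fun th => layer sigma x th L al)).
  exact: twice_differentiable_layer.
by apply/funext => th'; rewrite mxE.
Qed.

End network.

(** Passes from the vector-valued smoothness assumed of the reparametrization to the coordinatewise
    form used in the chain rule. *)
Lemma twice_differentiable_rV_coord {R : realType} {m q : nat}
    (f : 'rV[R]_m -> 'rV[R]_q) (x : 'rV[R]_m) (a : 'I_q) :
  (forall y, differentiable f y) ->
  (forall v y, differentiable ('D_v f) y) ->
  twice_differentiable (fun y => f y 0 a) x.
Proof.
move=> f1 f2.
apply: (@near_twice_differentiable _ _ _ (fun i y => ('D_(ebasis R i) f y) 0 a)).
- by near=> y; exact: differentiable_rV_coord.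
- move=> i; near=> y; rewrite /partial derive_rV_coord//.
  exact: diff_derivable.
- by move=> i; exact: differentiable_rV_coord.
Unshelve. all: by end_near. Qed.

(** * Quadratic remainder estimates and finite sums of integrals *)

Lemma ler_coord_norm {R : realType} {m} (k : 'rV[R]_m) a : `|k 0 a| <= `|k|.
Proof.
rewrite [leRHS]/Num.Def.normr/= mx_normrE.
exact: (@le_bigmax _ _ _ _ (fun ij : 'I_1 * 'I_m => `|k ij.1 ij.2|) (0, a)).
Qed.

Lemma differentiable_quadratic {R : realType} {q} (f : 'rV[R]_q -> R) x
    (c : 'I_q -> R) (M r : R) : 0 < r ->
  (forall k, `|k| <= r ->
     `|f (k + x) - f x - \sum_(a < q) k 0 a * c a| <= M * `|k| ^+ 2) ->
  differentiable f x /\ forall a, partial f a x = c a.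
Proof.
move=> r0 fM.
pose df (k : 'rV[R]_q) : R := \sum_(a < q) k 0 a * c a.
have df_lin : linear df.
  move=> s u v; rewrite /df scaler_sumr -big_split/=; apply: eq_bigr => a _.
  by rewrite !mxE mulrDl /GRing.scale/= mulrA.
pose dfM := GRing.isLinear.Build _ _ _ _ _ df_lin.
pose dfL : {linear 'rV[R]_q -> R} := HB.pack df dfM.
have dfc : continuous dfL.
  move=> k; apply: differentiable_continuous.
  apply: (@differentiable_sumf _ _ _ _ (fun a (k : 'rV[R]_q) => k 0 a * c a)) => a.
  apply: differentiableM; last exact: differentiable_cst.
  exact: differentiable_coord.
have [fd fE] : is_diff x f dfL.
  apply: is_diff_near => // e e0.
  (* Within this radius [M * |k| <= e]; the constant [M] has no prescribed sign, hence the positive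
     denominator [1 + |M|]. *)
  have eM : 0 < e / (1 + `|M|) by rewrite divr_gt0// ltr_wpDr.
  near=> k.
  have kr : `|k| <= r by near: k; exact: (@nbhs0_le R 'rV[R]_q).
  have ke : `|k| <= e / (1 + `|M|) by near: k; exact: (@nbhs0_le R 'rV[R]_q).
  apply: (le_trans (fM _ kr)); rewrite expr2 mulrA ler_wpM2r//.
  apply: (@le_trans _ _ ((1 + `|M|) * `|k|)).
    by rewrite ler_wpM2r// (le_trans (ler_norm _))// lerDr.
  by rewrite mulrC -ler_pdivlMr// ltr_wpDr.
split=> // a; rewrite /partial deriveE// fE /= /df (bigD1 a)//= big1 ?addr0.
  by rewrite !mxE !eqxx mul1r.
by move=> b ba; rewrite !mxE (negbTE ba) andbF mul0r.
Unshelve. all: by end_near. Qed.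

(** From [1 + u <= exp u] and [1 - u <= exp (- u)], the remainder lies between 0 and
    [u * (exp u - 1)]. This is at most [u^2 * exp u] for [u >= 0] and at most [u^2] for [u < 0]. *)
Lemma expR_taylor1 {R : realType} (u : R) :
  `|expR u - 1 - u| <= u ^+ 2 * expR `|u|.
Proof.
have h1 := expR_ge1Dx u; have h2 := expR_ge1Dx (- u).
have e0 := expR_gt0 u.
have h3 : expR u - 1 <= u * expR u.
  have : expR u * (1 - u) <= expR u * expR (- u) by rewrite ler_pM2l.
  by rewrite -expRD subrr expR0; lra.
have e1 : 1 <= expR `|u| by rewrite -expR0 ler_expR.
rewrite ger0_norm; last by lra.
have [u0|u0] := leP 0 u.
  have : u * (expR u - 1) <= u * (u * expR u) by rewrite ler_wpM2l.
  by rewrite (ger0_norm u0) expr2; lra.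
have : u ^+ 2 * 1 <= u ^+ 2 * expR `|u| by rewrite ler_wpM2l// sqr_ge0.
have : u * (expR u - 1) <= u * u by rewrite ler_wnM2l//; lra.
by rewrite expr2; lra.
Qed.

Lemma integrable_sum_ord {d} {T : measurableType d} {R : realType}
    (mu : {measure set T -> \bar R}) {q} (f : 'I_q -> T -> R) :
  (forall a, mu.-integrable setT (EFin \o f a)) ->
  mu.-integrable setT (EFin \o (fun y => \sum_(a < q) f a y)).
Proof.
move=> fi; have := integrable_sum measurableT (index_enum _) (P := predT) (fun a _ => fi a).
apply: eq_integrable => // y _; exact: sumEFin.
Qed.

Lemma Rintegral_sum_ord {d} {T : measurableType d} {R : realType}
    (mu : {measure set T -> \bar R}) {q} (f : 'I_q -> T -> R) :
  (forall a, mu.-integrable setT (EFin \o f a)) ->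
  \int[mu]_y (\sum_(a < q) f a y) = \sum_(a < q) \int[mu]_y f a y.
Proof.
elim: q f => [f _|q IH f fi].
  under eq_Rintegral do rewrite big_ord0.
  by rewrite big_ord0 /Rintegral integral0.
under eq_Rintegral do rewrite big_ord_recl.
rewrite RintegralD ?IH ?big_ord_recl//.
exact: integrable_sum_ord.
Qed.

(** * Exponential families: tail bounds and differentiation of moments in the natural parameter *)

Section exponential_family.
Context {R : realType} {dY : measure_display} {Y : measurableType dY} {q : nat}.
Variables (nu : {measure set Y -> \bar R}) (t : Y -> 'rV[R]_q).
Hypothesis mt : forall a, measurable_fun setT (fun y => t y 0 a).

Definition tnorm1 (y : Y) : R := \sum_(a < q) `|t y 0 a|.

Lemma tnorm1_ge0 y : 0 <= tnorm1 y.
Proof. exact: sumr_ge0. Qed.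

Lemma measurable_tnorm1 : measurable_fun setT tnorm1.
Proof.
by apply: measurable_sum => a; exact: measurableT_comp.
Qed.

Lemma measurable_dotp h : measurable_fun setT (fun y => dotp (t y) h).
Proof. by apply: measurable_sum => a; exact: measurable_funM. Qed.

Lemma measurable_expR_dotp h : measurable_fun setT (fun y => expR (dotp (t y) h)).
Proof. exact: (measurableT_comp (@measurable_expR R) (measurable_dotp h)). Qed.

Lemma norm_dotp_le y k : `|dotp (t y) k| <= tnorm1 y * `|k|.
Proof.
rewrite mulr_suml; apply: (le_trans (ler_norm_sum _ _ _)).
by apply: ler_sum => a _; rewrite normrM ler_wpM2l// ler_coord_norm.
Qed.

Lemma dotpDr (u h k : 'rV[R]_q) : dotp u (h + k) = dotp u h + dotp u k.
Proof.
by rewrite -big_split/=; apply: eq_bigr => a _; rewrite mxE mulrDr.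
Qed.

(* |t|_1 = t . e for the sign vector e of t, so exp (d |t|_1) is dominated by
   the sum of exp (d t . e) over all sign vectors e. *)
Lemma expR_tnorm1_integrable h : interior (natparam nu t) h ->
  exists2 d, 0 < d &
    nu.-integrable setT (fun y => (expR (d * tnorm1 y + dotp (t y) h))%:E).
Proof.
move=> /nbhs_ballP[e /= e0 eh]; exists (e / 2); first by rewrite divr_gt0.
set d := e / 2; have d0 : 0 < d by rewrite divr_gt0.
pose sgn (f : {ffun 'I_q -> bool}) : 'rV[R]_q := \row_a (if f a then d else - d).
have sgn_int f : nu.-integrable setT (fun y => (expR (dotp (t y) (sgn f + h)))%:E).
  apply/integrableP; split.
    by apply/measurable_EFinP; exact: measurable_expR_dotp.
  have : natparam nu t (sgn f + h).
    apply: eh; rewrite mx_norm_ball /ball_/= opprD addrCA subrr addr0 normrN.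
    rewrite (@le_lt_trans _ _ d)//; last by rewrite /d ltr_pdivrMr// ltr_pMr ?ltr1n.
    rewrite [leLHS]/Num.Def.normr/= mx_normrE (bigmax_le _ (ltW d0))//= => ij _.
    by rewrite mxE; case: ifP => _; rewrite ?normrN gtr0_norm.
  rewrite /natparam /partfun /=; apply: le_lt_trans.
  by under eq_integral do rewrite ger0_norm ?expR_ge0//.
have := integrable_sum measurableT (index_enum _) (P := predT) (fun f _ => sgn_int f).
apply: le_integrable => //.
  apply/measurable_EFinP; apply: (measurableT_comp (@measurable_expR R)).
  apply: measurable_funD; last exact: measurable_dotp.
  by apply: measurable_funM => //; exact: measurable_tnorm1.
move=> y _; rewrite sumEFin !abse_EFin lee_fin.
rewrite ger0_norm ?expR_ge0// ger0_norm; last first.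
  by apply: sumr_ge0 => ? _; exact: expR_ge0.
(* For the sign pattern of [t y] itself, [dotp (t y) (sgn f0)] equals [d * tnorm1 y], so this single
   term of the sum already reaches the integrand. *)
pose f0 : {ffun 'I_q -> bool} := [ffun a => 0 <= t y 0 a].
rewrite (bigD1 f0)//= ler_wpDr//.
  by apply: sumr_ge0 => ? _; exact: expR_ge0.
rewrite ler_expR dotpDr lerD2r mulr_sumr; apply: ler_sum => a _.
rewrite !mxE ffunE; case: ifPn => [a0|a0].
  by rewrite ger0_norm// mulrC.
by rewrite ltr0_norm ?ltNge// mulrN mulrC mulrN.
Qed.

(* Requiring the bound for every rate [r] makes the class closed under products. *)
Definition subexponential (phi : Y -> R) :=
  measurable_fun setT phi /\
  forall r, 0 < r -> exists2 K, 0 <= K &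
    forall y, `|phi y| <= K * expR (r * tnorm1 y).

Lemma subexponential_cst c : subexponential (fun=> c).
Proof.
split; first exact: measurable_cst.
move=> r r0; exists `|c| => // y; rewrite ler_peMr//.
by rewrite -expR0 ler_expR mulr_ge0 ?tnorm1_ge0// ltW.
Qed.

Lemma subexponentialD f g :
  subexponential f -> subexponential g -> subexponential (fun y => f y + g y).
Proof.
move=> [mf fr] [mg gr]; split; first exact: measurable_funD.
move=> r r0; have [K K0 fK] := fr _ r0; have [M M0 gM] := gr _ r0.
exists (K + M); first exact: addr_ge0.
by move=> y; rewrite mulrDl (le_trans (ler_normD _ _))// lerD.
Qed.

Lemma subexponentialM f g :
  subexponential f -> subexponential g -> subexponential (fun y => f y * g y).
Proof.
move=> [mf fr] [mg gr]; split; first exact: measurable_funM.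
move=> r r0; have r20 : 0 < r / 2 by rewrite divr_gt0.
have [K K0 fK] := fr _ r20; have [M M0 gM] := gr _ r20.
exists (K * M); first exact: mulr_ge0.
move=> y; rewrite (splitr r) mulrDl expRD mulrACA normrM.
by rewrite ler_pM.
Qed.

Lemma subexponential_sum {p} (f : 'I_p -> Y -> R) :
  (forall i, subexponential (f i)) -> subexponential (fun y => \sum_i f i y).
Proof.
elim: p f => [|p IH] f fs.
  under eq_fun do rewrite big_ord0; exact: subexponential_cst.
under eq_fun do rewrite big_ord_recl; apply: subexponentialD => //; exact: IH.
Qed.

Lemma subexponential_tnorm1 : subexponential tnorm1.
Proof.
split; first exact: measurable_tnorm1.
(* The constant comes from [r * s <= exp (r * s)] with [s = tnorm1 y]. *)
move=> r r0; exists r^-1; first by rewrite invr_ge0 ltW.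
move=> y; rewrite ger0_norm ?tnorm1_ge0// ler_pdivlMl//.
by rewrite (le_trans _ (expR_ge1Dx _))// lerDr.
Qed.

Lemma subexponential_coord a : subexponential (fun y => t y 0 a).
Proof.
split=> // r r0; have [_ /(_ r r0)[K K0 HK]] := subexponential_tnorm1.
exists K => // y; apply: le_trans (HK y).
rewrite (ger0_norm (tnorm1_ge0 y)) /tnorm1 (bigD1 a)//= lerDl.
exact: sumr_ge0.
Qed.


Section moments.
Variables (h0 : 'rV[R]_q) (d : R).
Hypothesis d0 : 0 < d.
Hypothesis hd :
  nu.-integrable setT (fun y => (expR (d * tnorm1 y + dotp (t y) h0))%:E).

(** Unnormalized moment; for [phi = 1] it is the real-valued partition function. *)
Definition moment (phi : Y -> R) (h : 'rV[R]_q) : R :=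
  \int[nu]_y (phi y * expR (dotp (t y) h)).

Lemma expR_dotp_le y k r : `|k| <= r -> expR (dotp (t y) k) <= expR (r * tnorm1 y).
Proof.
move=> kr; rewrite ler_expR (le_trans (ler_norm _))// (le_trans (norm_dotp_le _ _))//.
by rewrite mulrC ler_wpM2r// tnorm1_ge0.
Qed.

(** The rate [d] is split: [|h - h0|] pays for moving the parameter from [h0] to [h], and the
    positive rest absorbs the growth of [phi]. *)
Lemma subexponential_integrable phi h : subexponential phi -> `|h - h0| < d ->
  nu.-integrable setT (EFin \o (fun y => phi y * expR (dotp (t y) h))).
Proof.
move=> [mphi phir] hh0.
have [|K K0 phiK] := phir (d - `|h - h0|); first by rewrite subr_gt0.
have := integrableZl measurableT K hd; apply: le_integrable => //.
  apply/measurable_EFinP; apply: measurable_funM => //.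
  exact: measurable_expR_dotp.
move=> y _; rewrite /= lee_fin !normrM (ger0_norm K0).
rewrite !(ger0_norm (expR_ge0 _)).
rewrite -{1}(subrK h0 h) dotpDr expRD.
apply: (@le_trans _ _ (K * expR ((d - `|h - h0|) * tnorm1 y) *
    (expR (`|h - h0| * tnorm1 y) * expR (dotp (t y) h0)))).
  by rewrite ler_pM ?mulr_ge0 ?expR_ge0// ler_pM ?expR_ge0// expR_dotp_le.
by rewrite mulrA -(mulrA K) -expRD -mulrDl subrK -mulrA -expRD.
Qed.

(** Differentiation under the integral: the first order Taylor remainder of [exp (t . k)] is bounded
    pointwise by [|k|^2] times a fixed integrable function. The partials are again moments of
    subexponential functions, so the lemma can be iterated. *)
Lemma differentiable_moment phi h : subexponential phi -> `|h - h0| <= d / 4 ->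
  differentiable (moment phi) h /\
  forall a, partial (moment phi) a h = moment (fun y => phi y * t y 0 a) h.
Proof.
move=> sphi hh0; have d40 : 0 < d / 4 by rewrite divr_gt0.
have d4d : d / 4 < d by rewrite ltr_pdivrMr// ltr_pMr// ltr1n.
have [_ /(_ (d / 4) d40)[K K0 phiK]] :
    subexponential (fun y => phi y * tnorm1 y * tnorm1 y).
  by do 2 (apply: subexponentialM; last exact: subexponential_tnorm1).
(* Three quarters of the rate [d] are spent: one on [phi * tnorm1^2], one on the shift from [h0] to
   [h], one on the exponential in the Taylor bound. [M] therefore dominates uniformly in [k]. *)
pose M := K * \int[nu]_y expR (d * tnorm1 y + dotp (t y) h0).
apply: (@differentiable_quadratic _ _ _ _ _ M (d / 4)) => // k kd.
have i1 : nu.-integrable setT (EFin \o (fun y => phi y * expR (dotp (t y) (k + h)))).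
  apply: subexponential_integrable => //; rewrite -addrA.
  rewrite (le_lt_trans (ler_normD _ _))// (@le_lt_trans _ _ (d / 4 + d / 4)) ?lerD//.
  by lra.
have i2 : nu.-integrable setT (EFin \o (fun y => phi y * expR (dotp (t y) h))).
  by apply: subexponential_integrable => //; exact: le_lt_trans d4d.
have i3 a : nu.-integrable setT (EFin \o (fun y => phi y * t y 0 a * expR (dotp (t y) h))).
  apply: subexponential_integrable; last exact: le_lt_trans d4d.
  by apply: subexponentialM => //; exact: subexponential_coord.
have i4 a : nu.-integrable setT
    (EFin \o (fun y => k 0 a * (phi y * t y 0 a * expR (dotp (t y) h)))).
  exact: integrableZl (i3 a).
have i5 := integrable_sum_ord _ _ i4.
have i12 := integrableB measurableT i1 i2.
have i125 := integrableB measurableT i12 i5.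
have -> : \sum_(a < q) k 0 a * moment (fun y => phi y * t y 0 a) h =
    \int[nu]_y \sum_(a < q) k 0 a * (phi y * t y 0 a * expR (dotp (t y) h)).
  by rewrite Rintegral_sum_ord//; apply: eq_bigr => a _; rewrite RintegralZl.
rewrite /moment -RintegralB// -RintegralB//.
apply: (le_trans (le_normr_Rintegral _ _)) => //.
rewrite /M mulrAC -RintegralZl//; apply: le_Rintegral => //.
- exact: integrable_norm i125.
- exact: (integrableZl measurableT (K * `|k| ^+ 2) hd).
move=> y _.
have -> : \sum_(a < q) k 0 a * (phi y * t y 0 a * expR (dotp (t y) h)) =
    phi y * expR (dotp (t y) h) * dotp (t y) k.
  by rewrite mulr_sumr; apply: eq_bigr => a _; ring.
rewrite dotpDr expRD.
have -> : phi y * (expR (dotp (t y) k) * expR (dotp (t y) h)) -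
    phi y * expR (dotp (t y) h) - phi y * expR (dotp (t y) h) * dotp (t y) k =
    phi y * expR (dotp (t y) h) * (expR (dotp (t y) k) - 1 - dotp (t y) k) by ring.
rewrite !normrM (ger0_norm (expR_ge0 _)).
apply: (@le_trans _ _ (`|phi y| * expR (dotp (t y) h) *
    ((tnorm1 y * `|k|) ^+ 2 * expR (d / 4 * tnorm1 y)))).
  rewrite ler_wpM2l ?mulr_ge0 ?expR_ge0//.
  apply: (le_trans (expR_taylor1 _)); rewrite ler_pM ?sqr_ge0 ?expR_ge0//.
    rewrite -[leLHS]ger0_norm ?sqr_ge0// normrX lerXn2r ?nnegrE//.
      by rewrite mulr_ge0 ?tnorm1_ge0.
    exact: norm_dotp_le.
  rewrite ler_expR (le_trans (norm_dotp_le _ _))// mulrC ler_wpM2r//.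
  exact: tnorm1_ge0.
have -> : `|phi y| * expR (dotp (t y) h) *
    ((tnorm1 y * `|k|) ^+ 2 * expR (d / 4 * tnorm1 y)) =
    `|phi y * tnorm1 y * tnorm1 y| * `|k| ^+ 2 *
     (expR (dotp (t y) h) * expR (d / 4 * tnorm1 y)).
  by rewrite !normrM !(ger0_norm (tnorm1_ge0 y)); ring.
apply: (@le_trans _ _ (K * expR (d / 4 * tnorm1 y) * `|k| ^+ 2 *
  (expR (d / 4 * tnorm1 y) * expR (dotp (t y) h0) * expR (d / 4 * tnorm1 y)))).
  rewrite ler_pM ?mulr_ge0 ?expR_ge0 ?sqr_ge0//.
    by rewrite ler_wpM2r ?sqr_ge0.
  rewrite ler_wpM2r ?expR_ge0// -{1}(subrK h0 h) dotpDr expRD.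
  by rewrite ler_wpM2r ?expR_ge0// expR_dotp_le.
rewrite [leLHS](_ : _ = K * `|k| ^+ 2 * (expR (d / 4 * tnorm1 y) *
  expR (d / 4 * tnorm1 y) * expR (d / 4 * tnorm1 y) * expR (dotp (t y) h0))); last by ring.
rewrite ler_wpM2l ?mulr_ge0 ?sqr_ge0// -!expRD ler_expR lerD2r -!mulrDl.
by rewrite ler_wpM2r ?tnorm1_ge0//; lra.
Qed.

End moments.

End exponential_family.

(** * Second order smoothness of the log-partition function and the log-likelihood *)

Section log_partition.
Context {R : realType} {dY : measure_display} {Y : measurableType dY} {q : nat}.
Variables (nu : {measure set Y -> \bar R}) (t : Y -> 'rV[R]_q).
Hypothesis mt : forall a, measurable_fun setT (fun y => t y 0 a).
Variable h0 : 'rV[R]_q.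
Hypothesis h0int : interior (natparam nu t) h0.
Hypothesis h0pos : 0 < fine (partfun nu t h0).

Lemma logpartE : logpart nu t = @ln R \o moment nu t (fun=> 1).
Proof.
apply/funext => h; rewrite /logpart /partfun /moment /Rintegral /=.
by under [in RHS]eq_integral do rewrite mul1r.
Qed.

Lemma moment1_gt0 : 0 < moment nu t (fun=> 1) h0.
Proof.
move: h0pos; rewrite /partfun /moment /Rintegral.
by under [X in _ -> 0 < fine X]eq_integral do rewrite mul1r.
Qed.

(** Two applications of [differentiable_moment]: to the constant 1 at all points near [h0], then to
    the coordinates of [t] at [h0]. *)
Lemma twice_differentiable_moment1 : twice_differentiable (moment nu t (fun=> 1)) h0.
Proof.
have [d d0 hd] := expR_tnorm1_integrable nu t mt h0 h0int.
have d40 : 0 < d / 4 by rewrite divr_gt0.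
have hh0 : \forall h \near h0, `|h - h0| <= d / 4.
  near=> h; rewrite distrC; near: h.
  exact: (@cvgr_dist_le _ _ _ _ _ id h0).
have s1 : subexponential t (fun=> 1) by exact: subexponential_cst.
apply: (@near_twice_differentiable _ _ _
    (fun a => moment nu t (fun y => 1 * t y 0 a))).
- near=> h; have [|//] := differentiable_moment nu t mt h0 d d0 hd _ h s1.
  by near: h.
- move=> a; near=> h.
  have [|_ ->//] := differentiable_moment nu t mt h0 d d0 hd _ h s1.
  by near: h.
- move=> a; have [||//] := differentiable_moment nu t mt h0 d d0 hd
      (fun y => 1 * t y 0 a) h0.
    by apply: subexponentialM => //; exact: subexponential_coord.
  by rewrite subrr normr0 ltW.
Unshelve. all: by end_near. Qed.

Lemma twice_differentiable_logpart : twice_differentiable (logpart nu t) h0.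
Proof.
rewrite logpartE; apply: twice_differentiable_comp1.
- near=> z; apply: ex_derive; apply: is_derive1_ln.
  near: z; exact: lt_nbhsr moment1_gt0.
- apply/derivable1_diffP; apply: (@near_eq_differentiable _ _ _ (@GRing.inv R)).
    near=> z; rewrite derive1E; apply/esym; apply: derive_val.
    apply: is_derive1_ln.
    near: z; exact: lt_nbhsr moment1_gt0.
  by apply: differentiable_Rinv; rewrite gt_eqF// moment1_gt0.
- exact: twice_differentiable_moment1.
Unshelve. all: by end_near. Qed.

Lemma near_partial_loglik y a : \forall h \near h0,
  partial (loglik nu t y) a h = t y 0 a - partial (logpart nu t) a h.
Proof.
have [l1 _] := twice_differentiable_logpart.
near=> h.
have dl : differentiable (logpart nu t) h by near: h.
have dt b : differentiable (fun h : 'rV[R]_q => t y 0 b * h 0 b) h.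
  by apply: differentiableM; [exact: differentiable_cst|exact: differentiable_coord].
rewrite /partial (@deriveB _ _ _ (dotp (t y)) (logpart nu t)); last 2 first.
- apply: diff_derivable.
  exact: (@differentiable_sumf _ _ _ _ (fun b (h : 'rV[R]_q) => t y 0 b * h 0 b)).
- exact: diff_derivable.
congr (_ - _).
rewrite (@derive_sumf _ _ _ (fun b (h : 'rV[R]_q) => t y 0 b * h 0 b)); last first.
  by move=> b; exact: diff_derivable.
have dE b : 'D_(ebasis R a) (fun h : 'rV[R]_q => t y 0 b * h 0 b) h = t y 0 b * ebasis R a 0 b.
  rewrite (@deriveMl _ _ (fun h : 'rV[R]_q => h 0 b)); last first.
    by apply: diff_derivable; exact: differentiable_coord.
  by rewrite (@derive_rV_coord _ _ _ id) ?derive_id.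
under eq_bigr do rewrite dE.
rewrite (bigD1 a)//= big1 ?addr0; first by rewrite !mxE !eqxx mulr1.
by move=> b ba; rewrite !mxE (negbTE ba) andbF mulr0.
Unshelve. all: by end_near. Qed.

Lemma twice_differentiable_loglik y : twice_differentiable (loglik nu t y) h0.
Proof.
have [l1 l2] := twice_differentiable_logpart.
apply: (@near_twice_differentiable _ _ _
  (fun a h => t y 0 a - partial (logpart nu t) a h)).
- near=> h; apply: differentiableB; last by near: h.
  apply: (@differentiable_sumf _ _ _ _ (fun b (h : 'rV[R]_q) => t y 0 b * h 0 b)) => b.
  by apply: differentiableM; [exact: differentiable_cst|exact: differentiable_coord].
- by move=> a; near=> h; apply/esym; near: h; exact: near_partial_loglik.
- by move=> a; apply: differentiableB => //; exact: differentiable_cst.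
Unshelve. all: by end_near. Qed.

(** The statistic enters linearly in [h], so the Hessian in [h] is the same for every sample. All
    randomness of [Ihat2] thus comes from the gradient in [h]. *)
Lemma partial2_loglik y a b :
  partial2 (loglik nu t y) a b h0 = - partial2 (logpart nu t) a b h0.
Proof.
have [l1 l2] := twice_differentiable_logpart.
rewrite /partial2 {1}/partial (near_eq_derive _ (near_partial_loglik y b)).
rewrite (@deriveB _ _ _ (fun=> t y 0 b) (partial (logpart nu t) b)).
- by rewrite derive_cst sub0r.
- exact: derivable_cst.
- exact: diff_derivable.
Qed.

End log_partition.

(** * Integration against a law given by a density *)

Section integral_density.
Import HBNNSimple.

(** The density formula is applied on the level sets of simple functions, then monotone convergence
    passes to [f] on both sides. *)
Lemma ge0_integral_density {d} {T : measurableType d} {R : realType}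
    (mu nu : {measure set T -> \bar R}) (g : T -> R) (f : T -> \bar R) :
  measurable_fun setT g -> (forall x, 0 <= g x) ->
  (forall A, measurable A -> nu A = \int[mu]_(x in A) (g x)%:E)%E ->
  measurable_fun setT f -> (forall x, 0 <= f x)%E ->
  (\int[nu]_x f x = \int[mu]_x (f x * (g x)%:E))%E.
Proof.
move=> mg g0 nuE mf f0.
have mgE : measurable_fun setT (EFin \o g) by exact/measurable_EFinP.
pose h := nnsfun_approx measurableT mf.
have hf x : (EFin \o h n) x @[n --> \oo] --> f x.
  by apply: cvg_nnsfun_approx => //.
have simple n : (\int[nu]_x (h n x)%:E = \int[mu]_x ((h n x)%:E * (g x)%:E))%E.
  have mr r : measurable (h n @^-1` [set r]) by exact: measurable_funPTI.
  have mind r : measurable_fun setT (fun x => (r * \1_(h n @^-1` [set r]) x)%:E).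
    by apply/measurable_EFinP; apply: measurable_funM => //; exact: measurable_indic.
  have hE x : (h n x)%:E = (\sum_(r \in range (h n)) (r * \1_(h n @^-1` [set r]) x)%:E)%E.
    by rewrite fsumEFin// -fimfunE.
  rewrite integralT_nnsfun sintegralE.
  transitivity (\int[mu]_x (\sum_(r \in range (h n))
      (r * \1_(h n @^-1` [set r]) x)%:E * (g x)%:E))%E; last first.
    apply: eq_integral => x _; rewrite hE ge0_mule_fsuml// => r.
    exact: nnfun_muleindic_ge0.
  rewrite ge0_integral_fsum//; last 2 first.
  - by move=> r; exact: emeasurable_funM.
  - by move=> r x _; rewrite mule_ge0 ?lee_fin//; exact: nnfun_muleindic_ge0.
  apply: eq_fsbigr => r /[!inE] -[x _ xr].
  have r0 : 0 <= r by rewrite -xr.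
  rewrite nuE// integral_mkcond -ge0_integralZl//.
  - apply: eq_integral => y _; rewrite EFinM -muleA; congr (_ * _)%E.
    by rewrite epatch_indic muleC.
  - by apply: (measurable_restrictT _ (mr r)).1; exact: measurable_funTS mgE.
  - by move=> y _; apply: erestrict_ge0 => z _; rewrite lee_fin.
transitivity (limn (fun n => \int[nu]_x (h n x)%:E)%E).
  rewrite -monotone_convergence//.
  - by apply: eq_integral => x _; apply/esym/cvg_lim => //; exact: hf.
  - by move=> n; apply/measurable_EFinP.
  - by move=> n x _; rewrite lee_fin.
  - by move=> x _ a b ab; rewrite lee_fin; exact/lefP/nd_nnsfun_approx.
under eq_fun do rewrite simple.
rewrite -monotone_convergence//.
- apply: eq_integral => x _; apply/cvg_lim => //.
  by apply: cvgeZr => //; exact: hf.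
- by move=> n; apply: emeasurable_funM => //; exact/measurable_EFinP.
- by move=> n x _; rewrite mule_ge0 ?lee_fin.
- move=> x _ a b ab; rewrite lee_wpmul2r ?lee_fin//.
  exact/lefP/nd_nnsfun_approx.
Qed.

End integral_density.

Section law_with_density.
Context {dO : measure_display} {Omega : measurableType dO} {R : realType}.
Context {dY : measure_display} {Y : measurableType dY}.
Variables (P : probability Omega R) (nu : {measure set Y -> \bar R}).
Variables (X : {mfun Omega >-> Y}) (g : Y -> R).
Hypothesis mg : measurable_fun setT g.
Hypothesis g0 : forall y, 0 <= g y.
Hypothesis lawX : forall A, measurable A ->
  P (X @^-1` A) = (\int[nu]_(y in A) (g y)%:E)%E.

Lemma ge0_integral_law (f : Y -> \bar R) :
  measurable_fun setT f -> (forall y, 0 <= f y)%E ->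
  (\int[P]_w f (X w) = \int[nu]_y (f y * (g y)%:E))%E.
Proof.
move=> mf f0; rewrite -(ge0_integral_density nu (distribution P X))//.
by rewrite ge0_integral_distribution.
Qed.

(** A nonnegative density commutes with positive and negative parts, so the nonnegative case applies
    to each separately. *)
Lemma integral_law (f : Y -> R) : measurable_fun setT f ->
  (\int[P]_w (f (X w))%:E = \int[nu]_y (f y * g y)%:E)%E.
Proof.
move=> mf; have mfE : measurable_fun setT (EFin \o f) by exact/measurable_EFinP.
rewrite [LHS]integralE [RHS]integralE.
have pos y : ((fun y => (f y * g y)%:E)^\+ y = (EFin \o f)^\+ y * (g y)%:E)%E.
  rewrite !funeposE -!EFin_max -EFinM; congr EFin.
  by rewrite maxr_pMl// mul0r.
have neg y : ((fun y => (f y * g y)%:E)^\- y = (EFin \o f)^\- y * (g y)%:E)%E.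
  rewrite !funenegE -!EFin_max -EFinM; congr EFin.
  by rewrite maxr_pMl// mul0r mulNr.
congr (_ - _)%E.
  under [RHS]eq_integral do rewrite pos.
  rewrite -(ge0_integral_law (EFin \o f)^\+%E)//; last exact: measurable_funepos.
  by apply: eq_integral => w _; rewrite !funeposE.
under [RHS]eq_integral do rewrite neg.
rewrite -(ge0_integral_law (EFin \o f)^\-%E)//; last exact: measurable_funeneg.
by apply: eq_integral => w _; rewrite !funenegE.
Qed.

Lemma integrable_law (f : Y -> R) : measurable_fun setT f ->
  nu.-integrable setT (EFin \o (fun y => f y * g y)) ->
  P.-integrable setT (EFin \o (f \o X)).
Proof.
move=> mf /integrableP[_ fi]; apply/integrableP; split.
  by apply/measurable_EFinP; exact: measurableT_comp.
rewrite (ge0_integral_law (fun y => (`|f y|)%:E)).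
- by move: fi; under eq_integral do rewrite /= normrM (ger0_norm (g0 _)) EFinM.
- by apply/measurable_EFinP; exact: measurableT_comp.
- by move=> y; rewrite lee_fin.
Qed.

End law_with_density.

Lemma integrable_sqr_Lfun2 {d} {T : measurableType d} {R : realType}
    (mu : {measure set T -> \bar R}) (f : T -> R) : measurable_fun setT f ->
  mu.-integrable setT (EFin \o (fun x => f x * f x)) -> f \in Lfun mu 2%:E.
Proof.
move=> mf /integrableP[_ fi]; rewrite inE; apply/andP; split; rewrite inE//=.
rewrite /finite_norm unlock /Lnorm; apply: poweR_lty.
apply: le_lt_trans fi; rewrite le_eqVlt; apply/orP; left; apply/eqP.
apply: eq_integral => x _ /=; rewrite (@powR_mulrn _ _ 2)//.
by rewrite expr2 normrM.
Qed.

(** * Expectation of a product under independence *)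

Section independence.
Context {dO : measure_display} {Omega : measurableType dO} {R : realType}.
Context {dY : measure_display} {Y : measurableType dY}.
Variables (P : probability Omega R) (X1 X2 : {mfun Omega >-> Y}).
Hypothesis indep : forall A B, measurable A -> measurable B ->
  P (X1 @^-1` A `&` X2 @^-1` B) = (P (X1 @^-1` A) * P (X2 @^-1` B))%E.

Lemma expectation_mul_indep (f g : Y -> R) :
  measurable_fun setT f -> measurable_fun setT g ->
  P.-integrable setT (EFin \o (f \o X1)) -> P.-integrable setT (EFin \o (g \o X2)) ->
  P.-integrable setT (EFin \o (fun w => f (X1 w) * g (X2 w))) ->
  (\int[P]_w (f (X1 w) * g (X2 w))%:E =
   \int[P]_w (f (X1 w))%:E * \int[P]_w (g (X2 w))%:E)%E.
Proof.
move=> mf mg fi gi fgi.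
pose XX w := (X1 w, X2 w).
have mXX : measurable_fun setT XX by exact: measurable_fun_pair.
pose XXm := isMeasurableFun.Build _ _ _ _ XX mXX.
pose XXp : {mfun Omega >-> (Y * Y)%type} := HB.pack XX XXm.
have mfg : measurable_fun setT (fun z : Y * Y => (f z.1 * g z.2)%:E).
  apply/measurable_EFinP; apply: measurable_funM.
    exact: (measurableT_comp mf).
  exact: (measurableT_comp mg).
(* Independence says that the joint law agrees with the product of the marginals on rectangles;
   uniqueness of the product measure extends this, and Fubini then factors the integral. *)
have prodE : forall A : set (Y * Y), measurable A ->
    (distribution P X1 \x distribution P X2)%E A = distribution P XXp A.
  apply: product_measure_unique => A B mA mB.
  exact: indep.
have i1 : (distribution P XXp).-integrable setT (fun z : Y * Y => (f z.1 * g z.2)%:E).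
  by apply: integrable_pushforward.
transitivity (\int[distribution P XXp]_z (f z.1 * g z.2)%:E)%E.
  by rewrite integral_distribution.
rewrite (eq_measure_integral (distribution P X1 \x distribution P X2)%E); last first.
  by move=> A mA _; apply/esym; exact: prodE.
rewrite -integral12_prod_meas1; last first.
  apply/integrableP; split => //.
  case/integrableP : i1 => _.
  rewrite (eq_measure_integral (distribution P X1 \x distribution P X2)%E)//.
  by move=> A mA _; apply/esym; exact: prodE.
have gi2 : (distribution P X2).-integrable setT (EFin \o g).
  by apply: integrable_pushforward => //; exact/measurable_EFinP.
have fi1 : (distribution P X1).-integrable setT (EFin \o f).
  by apply: integrable_pushforward => //; exact/measurable_EFinP.
transitivity (\int[distribution P X1]_x ((f x)%:E *
    \int[distribution P X2]_y (g y)%:E))%E.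
  apply: eq_integral => x _; rewrite /fubini_F/= -integralZl//.
have gfin : (\int[distribution P X2]_y (g y)%:E)%E \is a fin_num.
  exact: integrable_fin_num.
rewrite -(fineK gfin) integralZr// fineK//.
by rewrite !integral_distribution//; apply/measurable_EFinP.
Qed.

End independence.

(** * Bilinearity of the covariance on square integrable variables *)

Section covariance_bilinear.
Context {d : measure_display} {T : measurableType d} {R : realType}.
Variable P : probability T R.

Lemma Lfun2_Lfun1 (X : T -> R) : X \in Lfun P 2%:E -> X \in Lfun P 1.
Proof. by apply: Lfun_subset12; exact: fin_num_measure. Qed.

Lemma covariance_Lfun2_fin_num (X Y : T -> R) :
  X \in Lfun P 2%:E -> Y \in Lfun P 2%:E -> covariance P X Y \is a fin_num.
Proof.
move=> X2 Y2; apply: covariance_fin_num; [exact: Lfun2_Lfun1..|].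
exact: Lfun2_mul_Lfun1.
Qed.

Lemma Lfun2_sum {I : Type} (s : seq I) (c : I -> R) (X : I -> T -> R) :
  (forall a, X a \in Lfun P 2%:E) ->
  (fun w => \sum_(a <- s) c a * X a w) \in Lfun P 2%:E.
Proof.
move=> X2; elim: s => [|a s IH].
  by under eq_fun do rewrite big_nil; exact: Lfun_cst.
under eq_fun do rewrite big_cons.
rewrite (_ : (fun _ => _) =
  (c a \o* X a) \+ (fun w => \sum_(a <- s) c a * X a w)); last first.
  by apply/funext => w /=; rewrite mulrC.
by rewrite rpredD ?lee1n//= => ?; apply: Lfun_scale => //; rewrite ler1n.
Qed.

Lemma covariance_suml {I : Type} (s : seq I) (c : I -> R) (X : I -> T -> R) e Y :
  (forall a, X a \in Lfun P 2%:E) -> Y \in Lfun P 2%:E ->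
  covariance P (fun w => \sum_(a <- s) c a * X a w + e) Y =
  (\sum_(a <- s) c a * fine (covariance P (X a) Y))%:E.
Proof.
move=> X2 Y2.
rewrite (_ : (fun _ => _) = (fun w => \sum_(a <- s) c a * X a w) \+ cst e)//.
rewrite covarianceDl//; [|exact: Lfun2_sum|exact: Lfun_cst].
rewrite covariance_cst_l adde0; elim: s => [|a s IH].
  under [X in covariance P X _]eq_fun do rewrite big_nil.
  by rewrite covariance_cst_l big_nil.
under [X in covariance P X _]eq_fun do rewrite big_cons.
rewrite (_ : (fun _ => _) =
  (c a \o* X a) \+ (fun w => \sum_(a <- s) c a * X a w)); last first.
  by apply/funext => w /=; rewrite mulrC.
rewrite covarianceDl//; [|by apply: Lfun_scale => //; rewrite ler1n|exact: Lfun2_sum].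
rewrite covarianceZl; [|exact: Lfun2_Lfun1..|exact: Lfun2_mul_Lfun1].
by rewrite IH big_cons EFinD EFinM fineK// covariance_Lfun2_fin_num.
Qed.

(** The additive constants are included because [Ihat2] is affine in the sample means of [t]. Square
    integrability makes each covariance finite, so [fine] loses nothing. *)
Lemma covariance_bilinear {I J : Type} (s : seq I) (r : seq J)
    (c : I -> R) (c' : J -> R) (X : I -> T -> R) (Y : J -> T -> R) e e' :
  (forall a, X a \in Lfun P 2%:E) -> (forall b, Y b \in Lfun P 2%:E) ->
  covariance P (fun w => \sum_(a <- s) c a * X a w + e)
               (fun w => \sum_(b <- r) c' b * Y b w + e') =
  (\sum_(a <- s) \sum_(b <- r) c a * c' b * fine (covariance P (X a) (Y b)))%:E.
Proof.
move=> X2 Y2; rewrite covariance_suml//; last first.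
  rewrite (_ : (fun _ => _) = (fun w => \sum_(b <- r) c' b * Y b w) \+ cst e')//.
  by rewrite rpredD ?lee1n//= => ?; [exact: Lfun2_sum|exact: Lfun_cst].
congr EFin; apply: eq_bigr => a _.
rewrite covarianceC covariance_suml//= mulr_sumr; apply: eq_bigr => b _.
by rewrite mulrA covarianceC.
Qed.

End covariance_bilinear.

(** * Moments and covariances of the i.i.d. sample *)

Section sampling.
Context {R : realType} {dY : measure_display} {Y : measurableType dY} {q : nat}.
Variables (nu : {measure set Y -> \bar R}) (t : Y -> 'rV[R]_q).
Hypothesis mt : forall a, measurable_fun setT (fun y => t y 0 a).
Variable h0 : 'rV[R]_q.
Hypothesis h0int : interior (natparam nu t) h0.
Context {dO : measure_display} {Omega : measurableType dO} {N : nat}.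
Variables (P : probability Omega R) (Ys : 'I_N -> {mfun Omega >-> Y}).
Hypothesis N0 : (0 < N)%N.
Hypothesis indep : mutually_independent P (fun s => Ys s : Omega -> Y).
Hypothesis law : forall s A, measurable A ->
  P (Ys s @^-1` A) = (\int[nu]_(y in A) (expdens nu t h0 y)%:E)%E.

Lemma expdensE y : expdens nu t h0 y = expR (- logpart nu t h0) * expR (dotp (t y) h0).
Proof. by rewrite /expdens addrC expRD. Qed.

Lemma measurable_expdens : measurable_fun setT (expdens nu t h0).
Proof.
rewrite (_ : expdens _ _ _ = fun y => expR (- logpart nu t h0) * expR (dotp (t y) h0)).
  by apply: measurable_funM => //; exact: measurable_expR_dotp.
by apply/funext => y; rewrite expdensE.
Qed.

(** A vanishing partition function would give the law of the first sample total mass 0 instead of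
    1. *)
Lemma partfun_gt0 : 0 < fine (partfun nu t h0).
Proof.
have p0 : (0 <= partfun nu t h0)%E.
  by apply: integral_ge0 => y _; rewrite lee_fin expR_ge0.
rewrite lt_neqAle fine_ge0// andbT; apply/eqP => pe.
(* As [fine] also sends infinity to 0, finiteness at [h0] is what yields a genuine zero. *)
have pE : partfun nu t h0 = 0%E.
  rewrite -[LHS]fineK -?pe//; rewrite ge0_fin_numE//.
  exact: (interior_subset h0int).
have := law (Ordinal N0) setT measurableT.
rewrite preimage_setT probability_setT.
under eq_integral do rewrite expdensE EFinM.
rewrite ge0_integralZl; last 4 first.
- exact: measurableT.
- by apply/measurable_EFinP; exact: measurable_expR_dotp.
- by move=> y _; rewrite lee_fin expR_ge0.
- by rewrite lee_fin expR_ge0.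
rewrite -[X in (_ * X)%E]/(partfun nu t h0) pE mule0 => /eqP.
by rewrite eqe oner_eq0.
Qed.

Lemma subexponential_expdens_integrable phi : subexponential t phi ->
  nu.-integrable setT (EFin \o (fun y => phi y * expdens nu t h0 y)).
Proof.
move=> sphi; have [d d0 hd] := expR_tnorm1_integrable nu t mt h0 h0int.
have := subexponential_integrable nu t mt h0 d hd phi h0 sphi.
rewrite subrr normr0 => /(_ d0) /(integrableZl measurableT (expR (- logpart nu t h0))).
by apply: eq_integrable => // y _; rewrite /= -EFinM expdensE mulrCA.
Qed.

Lemma subexponential_sample_integrable phi s : subexponential t phi ->
  P.-integrable setT (EFin \o (phi \o Ys s)).
Proof.
move=> sphi; apply: (integrable_law P nu (Ys s) (expdens nu t h0)) => //.
- exact: measurable_expdens.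
- by move=> y; exact: expR_ge0.
- exact: law.
- by case: sphi.
- exact: subexponential_expdens_integrable.
Qed.

Lemma subexponential_sample_Lfun2 phi s : subexponential t phi ->
  phi \o Ys s \in Lfun P 2%:E.
Proof.
move=> sphi; apply: integrable_sqr_Lfun2.
  by apply: measurableT_comp => //; case: sphi.
apply: (subexponential_sample_integrable (fun y => phi y * phi y)).
exact: subexponentialM.
Qed.

Lemma integral_sample phi s : measurable_fun setT phi ->
  (\int[P]_w (phi (Ys s w))%:E = Emodel nu t h0 phi)%E.
Proof.
move=> mphi; rewrite (integral_law P nu (Ys s) (expdens nu t h0))//.
- exact: measurable_expdens.
- by move=> y; exact: expR_ge0.
- exact: law.
Qed.

(** Mutual independence is used with the whole space as event for every other sample. *)
Lemma indep_pair s s' A B : s != s' -> measurable A -> measurable B ->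
  P (Ys s @^-1` A `&` Ys s' @^-1` B) = (P (Ys s @^-1` A) * P (Ys s' @^-1` B))%E.
Proof.
move=> ss' mA mB.
pose C k := if k == s then A else if k == s' then B else setT.
have mC k : measurable (C k) by rewrite /C; case: ifP => // _; case: ifP.
have Cs : C s = A by rewrite /C eqxx.
have Cs' : C s' = B by rewrite /C eq_sym (negbTE ss') eqxx.
have := indep C mC; rewrite (bigD1 s)//= (bigD1 s')/=; last by rewrite eq_sym.
rewrite Cs Cs' big1 ?mule1 => [<-|k /andP[ks ks']]; last first.
  by rewrite /C (negbTE ks) (negbTE ks') preimage_setT probability_setT.
congr (P _); apply/seteqP; split => w /=.
  move=> [wA wB] k _; rewrite /C; case: ifP => [/eqP->//|_].
  by case: ifP => [/eqP->//|].
by move=> wC; split; [rewrite -Cs; exact: wC|rewrite -Cs'; exact: wC].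
Qed.

(** On the diagonal the law of the sample turns the covariance into the defining integral of
    [fisherI]; off it, the expectation of the product factors. *)
Lemma covariance_sample s s' al be :
  covariance P (fun w => t (Ys s w) 0 al) (fun w => t (Ys s' w) 0 be) =
  if s == s' then fisherI nu t h0 al be else 0%E.
Proof.
have sa a : subexponential t (fun y => t y 0 a) by exact: subexponential_coord.
case: eqVneq => [<-|ss'].
  rewrite covariance.unlock expectation.unlock /=.
  rewrite (integral_sample (fun y => t y 0 al))//.
  rewrite (integral_sample (fun y => t y 0 be))//.
  rewrite (integral_sample (fun y => (t y 0 al - _) * (t y 0 be - _)))//.
  by apply: measurable_funM; apply: measurable_funB.
have L2 a k : (fun w => t (Ys k w) 0 a) \in Lfun P 2%:E.
  exact: (subexponential_sample_Lfun2 (fun y => t y 0 a)).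
have prod1 := Lfun2_mul_Lfun1 (L2 al s) (L2 be s').
rewrite covarianceE//; [|exact: Lfun2_Lfun1..].
rewrite expectation.unlock/= (expectation_mul_indep P (Ys s) (Ys s') _
  (fun y => t y 0 al) (fun y => t y 0 be))//.
- rewrite subee// fin_numM//.
  + apply: integrable_fin_num => //.
    exact: (subexponential_sample_integrable (fun y => t y 0 al)).
  + apply: integrable_fin_num => //.
    exact: (subexponential_sample_integrable (fun y => t y 0 be)).
- by move=> A B; exact: indep_pair.
- exact: (subexponential_sample_integrable (fun y => t y 0 al)).
- exact: (subexponential_sample_integrable (fun y => t y 0 be)).
- exact/Lfun1_integrable.
Qed.

(** The entry is the covariance of two square integrable coordinates of one sample. *)
Lemma fisherI_fin_num al be : fisherI nu t h0 al be \is a fin_num.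
Proof.
have := covariance_sample (Ordinal N0) (Ordinal N0) al be; rewrite eqxx => <-.
apply: covariance_Lfun2_fin_num.
  by apply: (subexponential_sample_Lfun2 (fun y => t y 0 al)); exact: subexponential_coord.
by apply: (subexponential_sample_Lfun2 (fun y => t y 0 be)); exact: subexponential_coord.
Qed.

(** Both [Ihat1] and [Ihat2] are of this form by conversion, so the lemmas on [empmean] apply to
    them directly. *)
Definition empmean (phi : Y -> R) (w : Omega) : R :=
  N%:R^-1 * \sum_(s < N) phi (Ys s w).

Lemma empmean_Lfun2 phi : subexponential t phi -> empmean phi \in Lfun P 2%:E.
Proof.
move=> sphi; rewrite (_ : empmean phi =
    fun w => \sum_(s < N) N%:R^-1 * (phi \o Ys s) w); last first.
  by apply/funext => w; rewrite /empmean mulr_sumr.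
by apply: Lfun2_sum => s; exact: subexponential_sample_Lfun2.
Qed.

Lemma empmean_linear {I : finType} (c : I -> R) (phi : I -> Y -> R) e psi :
  (forall y, psi y = \sum_a c a * phi a y + e) ->
  forall w, empmean psi w = \sum_a c a * empmean (phi a) w + e.
Proof.
move=> psiE w; rewrite /empmean; under eq_bigr do rewrite psiE.
rewrite big_split/= mulrDr sumr_const card_ord -[e *+ N]mulr_natl mulrA.
rewrite mulVf ?mul1r; last by rewrite pnatr_eq0 -lt0n.
congr (_ + e); rewrite exchange_big/= mulr_sumr; apply: eq_bigr => a _.
by rewrite -mulr_sumr mulrCA.
Qed.

Lemma covariance_empmean_coord al be :
  covariance P (empmean (fun y => t y 0 al)) (empmean (fun y => t y 0 be)) =
  (N%:R^-1 * fine (fisherI nu t h0 al be))%:E.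
Proof.
have eE a : empmean (fun y => t y 0 a) =
    fun w => \sum_(s < N) N%:R^-1 * t (Ys s w) 0 a + 0.
  by apply/funext => w; rewrite /empmean mulr_sumr addr0.
have L2 a k : (fun w => t (Ys k w) 0 a) \in Lfun P 2%:E.
  by apply: (subexponential_sample_Lfun2 (fun y => t y 0 a)); exact: subexponential_coord.
rewrite !eE (covariance_bilinear P _ _ (fun=> N%:R^-1) (fun=> N%:R^-1)
  (fun s w => t (Ys s w) 0 al) (fun s w => t (Ys s w) 0 be))//; congr EFin.
(* Only the [N] diagonal terms survive, each with weight [1 / N^2]. *)
transitivity (\sum_(s < N) N%:R^-1 * N%:R^-1 * fine (fisherI nu t h0 al be)).
  apply: eq_bigr => s _; rewrite (bigD1 s)//= covariance_sample eqxx big1 ?addr0//.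
  by move=> s' ss'; rewrite covariance_sample eq_sym (negbTE ss') mulr0.
rewrite sumr_const card_ord -[LHS]mulr_natl !mulrA divff ?mul1r//.
by rewrite pnatr_eq0 -lt0n.
Qed.

End sampling.

(** * Rearrangement of multiple finite sums *)

Lemma exchange_big22 {R : nmodType} {I I' K K' : finType}
    (X : I -> I' -> K -> K' -> R) :
  \sum_p \sum_p' \sum_k \sum_k' X p p' k k' =
  \sum_k \sum_k' \sum_p \sum_p' X p p' k k'.
Proof.
rewrite pair_bigA/= [RHS]pair_bigA/=.
under eq_bigr do rewrite pair_bigA/=.
by rewrite exchange_big/=; under eq_bigr do rewrite -(pair_bigA _ (fun p p' => X p p' _ _)).
Qed.

(** Contracting the pullback of a bilinear form [V] amounts to evaluating [V] on the contracted
    vectors. Below, Jacobians are contracted with second derivatives of [hL]. *)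
Lemma sum_bilinear {R : comNzRingType} {I I' K K' : finType}
    (u : I -> R) (u' : I' -> R) (g : I -> K -> R) (g' : I' -> K' -> R)
    (V : K -> K' -> R) :
  \sum_p \sum_p' u p * u' p' * (\sum_k \sum_k' g p k * g' p' k' * V k k') =
  \sum_k \sum_k' (\sum_p u p * g p k) * (\sum_p' u' p' * g' p' k') * V k k'.
Proof.
transitivity (\sum_p \sum_p' \sum_k \sum_k'
    u p * g p k * (u' p' * g' p' k') * V k k').
  do 2 (apply: eq_bigr => ? _); rewrite mulr_sumr; apply: eq_bigr => ? _.
  by rewrite mulr_sumr; apply: eq_bigr => ? _; ring.
rewrite exchange_big22; do 2 (apply: eq_bigr => ? _).
rewrite big_distrlr/= mulr_suml; apply: eq_bigr => ? _.
by rewrite mulr_suml.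
Qed.

Lemma sum_bilinear2 {R : comNzRingType} {I K : finType}
    (u u' : I -> I -> R) (g : I -> I -> K -> R) (V : K -> K -> R) :
  \sum_a \sum_b \sum_c \sum_d u a b * u' c d *
     (\sum_k \sum_k' g a b k * g c d k' * V k k') =
  \sum_k \sum_k' (\sum_a \sum_b u a b * g a b k) *
     (\sum_c \sum_d u' c d * g c d k') * V k k'.
Proof.
rewrite pair_bigA/=.
under eq_bigr do rewrite pair_bigA/=.
rewrite (sum_bilinear (fun p : I * I => u p.1 p.2) (fun p : I * I => u' p.1 p.2)
  (fun p => g p.1 p.2) (fun p => g p.1 p.2)).
by do 2 (apply: eq_bigr => ? _); rewrite -!(pair_bigA _ (fun a b => _ a b * g a b _)).
Qed.

(** * Transformation of the two estimator covariances under reparametrization *)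

Theorem mainTheorem16
  (R : realType)
  (* network architecture: widths n_0, ..., n_L *)
  (L : nat) (n : nat -> nat)
  (hL1 : (1 <= L)%N) (hn : forall l, (1 <= l <= L)%N -> (1 <= n l)%N)
  (* activation sigma in C^2(R) *)
  (sigma : R -> R)
  (hs1 : forall z, derivable sigma z 1)
  (hs2 : forall z, derivable (derive1 sigma) z 1)
  (hs3 : continuous (derive1 (derive1 sigma)))
  (* fixed input x in R^{n_0} *)
  (x : 'rV[R]_(n 0%N))
  (* exponential family: base measure nu, sufficient statistic t *)
  (dY : measure_display) (Y : measurableType dY)
  (nu : {measure set Y -> \bar R}) (t : Y -> 'rV[R]_(n L))
  (ht : forall a : 'I_(n L), measurable_fun setT (fun y => t y 0 a))
  (* twice differentiable reparametrization theta = theta(xi) *)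
  (m : nat) (thetaof : 'rV[R]_m -> 'rV[R]_(dimtheta n L))
  (hth1 : forall xi, differentiable thetaof xi)
  (hth2 : forall (v xi : 'rV[R]_m), differentiable ('D_v thetaof) xi)
  (* the point xi (theta = theta(xi)) at which everything is evaluated *)
  (xi0 : 'rV[R]_m)
  (hint : interior (natparam nu t) (hL sigma x (thetaof xi0)))
  (* N i.i.d. samples y_1..y_N ~ p(y | x, theta(xi)) on a probability space *)
  (dO : measure_display) (Omega : measurableType dO) (P : probability Omega R)
  (N : nat) (hN : (1 <= N)%N) (Ys : 'I_N -> Omega -> Y)
  (hYm : forall s, measurable_fun setT (Ys s))
  (hind : mutually_independent P Ys)
  (hlaw : forall s A, measurable A ->
     P (Ys s @^-1` A) =
     (\int[nu]_(y in A) (expdens nu t (hL sigma x (thetaof xi0)) y)%:E)%E)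
  (i j k l : 'I_m) :
  let theta0 := thetaof xi0 in
  (* log-likelihoods in the theta and in the xi coordinates *)
  let ellT := fun (y : Y) (th : 'rV[R]_(dimtheta n L)) =>
                loglik nu t y (hL sigma x th) in
  let ellX := fun (y : Y) (xi : 'rV[R]_m) => ellT y (thetaof xi) in
  (* d theta_a / d xi_i  and  d^2 theta_a / d xi_i d xi_j  at xi0 *)
  let J := fun (a : 'I_(dimtheta n L)) (i : 'I_m) =>
             partial (fun xi => thetaof xi 0 a) i xi0 in
  let H := fun (a : 'I_(dimtheta n L)) (i j : 'I_m) =>
             partial2 (fun xi => thetaof xi 0 a) i j xi0 in
  (* d_a h_L^alpha  and  d_a d_b h_L^alpha  at theta0 *)
  let dh := fun (al : 'I_(n L)) (a : 'I_(dimtheta n L)) =>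
              partial (fun th => hL sigma x th 0 al) a theta0 in
  let d2h := fun (al : 'I_(n L)) (a b : 'I_(dimtheta n L)) =>
              partial2 (fun th => hL sigma x th 0 al) a b theta0 in
  let C := fun al be : 'I_(n L) =>
      \sum_a \sum_b \sum_c (J a i * J b j * H c k l * d2h al a b * dh be c)
    + \sum_a \sum_b \sum_c (H a i j * J b k * J c l * dh al a * d2h be b c)
    + \sum_a \sum_b (H a i j * H b k l * dh al a * dh be b) in
  covariance P (Ihat1 Ys ellX xi0 i j) (Ihat1 Ys ellX xi0 k l) =
    (\sum_a \sum_b \sum_c \sum_d
       (J a i * J b j * J c k * J d l)%:E *
       covariance P (Ihat1 Ys ellT theta0 a b) (Ihat1 Ys ellT theta0 c d))%E
  /\
  covariance P (Ihat2 Ys ellX xi0 i j) (Ihat2 Ys ellX xi0 k l) =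
    ((\sum_a \sum_b \sum_c \sum_d
       (J a i * J b j * J c k * J d l)%:E *
       covariance P (Ihat2 Ys ellT theta0 a b) (Ihat2 Ys ellT theta0 c d))
     + \sum_al \sum_be
       ((N%:R^-1 * C al be)%:E * fisherI nu t (hL sigma x theta0) al be))%E.
Proof.
move=> theta0 ellT ellX J H dh d2h C.
pose Ys' s : {mfun Omega >-> Y} :=
  HB.pack (Ys s) (isMeasurableFun.Build _ _ _ _ (Ys s) (hYm s)).
set h0 := hL sigma x theta0.
have pos := partfun_gt0 nu t ht h0 hint P Ys' hN hlaw.
have tl y : twice_differentiable (loglik nu t y) h0.
  exact: twice_differentiable_loglik.
have th al : twice_differentiable (fun th => hL sigma x th 0 al) theta0.
  exact: twice_differentiable_hL.
have tth a : twice_differentiable (fun xi => thetaof xi 0 a) xi0.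
  exact: twice_differentiable_rV_coord.
have tT y : twice_differentiable (ellT y) theta0.
  exact: twice_differentiable_comp (tl y) th.
(* Gradient and Hessian of the log-partition function. In [Ihat2] they enter only the additive
   constants [eT] and [eX], which covariances ignore. *)
pose F al := partial (logpart nu t) al h0.
pose F2 al be := partial2 (logpart nu t) al be h0.
have pT y a : partial (ellT y) a theta0 = \sum_al (t y 0 al - F al) * dh al a.
  have /nbhs_singleton -> := near_partial_comp _ _ (loglik nu t y) _ _ (tl y) th a.
  apply: eq_bigr => al _.
  by have /nbhs_singleton -> := near_partial_loglik nu t ht h0 hint pos y al.
have pX y i' : partial (ellX y) i' xi0 = \sum_a partial (ellT y) a theta0 * J a i'.
  by have /nbhs_singleton -> := near_partial_comp _ _ (ellT y) _ _ (tT y) tth i'.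
have p2T y a b : partial2 (ellT y) a b theta0 =
    \sum_al \sum_be (- F2 al be) * dh al a * dh be b +
    \sum_al (t y 0 al - F al) * d2h al a b.
  rewrite (partial2_comp _ _ (loglik nu t y) _ _ (tl y) th); congr (_ + _).
    apply: eq_bigr => al _; apply: eq_bigr => be _.
    by rewrite partial2_loglik.
  apply: eq_bigr => al _.
  by have /nbhs_singleton -> := near_partial_loglik nu t ht h0 hint pos y al.
have p2X y i' j' : partial2 (ellX y) i' j' xi0 =
    \sum_a \sum_b partial2 (ellT y) a b theta0 * J a i' * J b j' +
    \sum_b partial (ellT y) b theta0 * H b i' j'.
  by rewrite (partial2_comp _ _ (ellT y) _ _ (tT y) tth).
(* Only the formulas for the derivatives matter from here on; keeping the
   bodies would make [ring] unfold them when it compares atoms. *)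
clearbody ellX ellT J H dh d2h F F2.
split.
  (* First identity: [Ihat1] transforms as a tensor. Index pairs turn its double sum into one finite
     sum, as [covariance_bilinear] expects; each summand is quadratic in [t], hence
     subexponential. *)
  pose phi (p : 'I_(dimtheta n L) * 'I_(dimtheta n L)) y :=
    partial (ellT y) p.1 theta0 * partial (ellT y) p.2 theta0.
  have phi2 p : Ihat1 Ys ellT theta0 p.1 p.2 \in Lfun P 2%:E.
    apply: (empmean_Lfun2 nu t ht h0 hint P Ys' hlaw (phi p)).
    have sub a : subexponential t (fun y => partial (ellT y) a theta0).
      under eq_fun do rewrite pT.
      apply: (@subexponential_sum _ _ _ _ t _
        (fun al y => (t y 0 al - F al) * dh al a)) => al.
      apply: subexponentialM; last exact: subexponential_cst.
      by apply: subexponentialD; [exact: subexponential_coord|exact: subexponential_cst].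
    exact: subexponentialM.
  have I1E i' j' : Ihat1 Ys ellX xi0 i' j' =
      fun w => \sum_p J p.1 i' * J p.2 j' * Ihat1 Ys ellT theta0 p.1 p.2 w + 0.
    apply/funext => w.
    apply: (empmean_linear Ys' hN (fun p => J p.1 i' * J p.2 j') phi 0
      (fun y => partial (ellX y) i' xi0 * partial (ellX y) j' xi0) _ w) => y.
    rewrite addr0 !pX big_distrlr/= pair_bigA/=; apply: eq_bigr => p _.
    by rewrite mulrACA mulrC.
  rewrite !I1E (covariance_bilinear P _ _ _ _
    (fun p => Ihat1 Ys ellT theta0 p.1 p.2) (fun p => Ihat1 Ys ellT theta0 p.1 p.2))//.
  rewrite -sumEFin -(pair_bigA _ (fun a b => (\sum_(p : 'I_(dimtheta n L) * 'I_(dimtheta n L))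
    J a i * J b j * (J p.1 k * J p.2 l) *
    fine (covariance P (Ihat1 Ys ellT theta0 a b) (Ihat1 Ys ellT theta0 p.1 p.2)))%:E))/=.
  apply: eq_bigr => a _; apply: eq_bigr => b _.
  rewrite -sumEFin -(pair_bigA _ (fun c d => (J a i * J b j * (J c k * J d l) *
    fine (covariance P (Ihat1 Ys ellT theta0 a b) (Ihat1 Ys ellT theta0 c d)))%:E))/=.
  apply: eq_bigr => c _; apply: eq_bigr => d _.
  rewrite EFinM fineK ?mulrA//; apply: covariance_Lfun2_fin_num.
    exact: (phi2 (a, b)).
  exact: (phi2 (c, d)).
(* Second identity: every entry of [Ihat2], in either coordinate system, is affine in these
   means. *)
pose T al := empmean Ys' (fun y => t y 0 al).
have T2 al : T al \in Lfun P 2%:E.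
  apply: (empmean_Lfun2 nu t ht h0 hint P Ys' hlaw).
  exact: subexponential_coord.
pose V al be := fine (covariance P (T al) (T be)).
have VE al be : V al be = N%:R^-1 * fine (fisherI nu t h0 al be).
  by rewrite /V (covariance_empmean_coord nu t ht h0 hint P Ys' hN hind hlaw).
(* [A] is the tensorial part and [B] the curvature part of the second derivative of the output
   coordinate [al] with respect to [xi], which is their sum. *)
pose A al i' j' := \sum_a \sum_b J a i' * J b j' * d2h al a b.
pose B al i' j' := \sum_b H b i' j' * dh al b.
pose eT a b := - (\sum_al \sum_be (- F2 al be) * dh al a * dh be b
                  - \sum_al F al * d2h al a b).
have p2Tl y a b : - partial2 (ellT y) a b theta0 =
    \sum_al (- d2h al a b) * t y 0 al + eT a b.
  rewrite p2T /eT; under [X in _ + X]eq_bigr do rewrite mulrBl.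
  rewrite [X in _ = X + _](eq_bigr (fun al => - (t y 0 al * d2h al a b))); last first.
    by move=> al _; ring.
  by rewrite sumrN sumrB; ring.
have I2T a b : Ihat2 Ys ellT theta0 a b =
    fun w => \sum_al (- d2h al a b) * T al w + eT a b.
  apply/funext => w.
  apply: (empmean_linear Ys' hN (fun al => - d2h al a b) (fun al y => t y 0 al)
    (eT a b) (fun y => - partial2 (ellT y) a b theta0) _ w) => y.
  exact: p2Tl.
pose eX i' j' := \sum_a \sum_b eT a b * J a i' * J b j' +
                 \sum_b (\sum_al F al * dh al b) * H b i' j'.
have I2X i' j' : Ihat2 Ys ellX xi0 i' j' =
    fun w => \sum_al (- (A al i' j' + B al i' j')) * T al w + eX i' j'.
  apply/funext => w.
  apply: (empmean_linear Ys' hN (fun al => - (A al i' j' + B al i' j'))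
    (fun al y => t y 0 al) (eX i' j') (fun y => - partial2 (ellX y) i' j' xi0) _ w) => y.
  have E1 : - (\sum_a \sum_b partial2 (ellT y) a b theta0 * J a i' * J b j') =
      \sum_al (- A al i' j') * t y 0 al + \sum_a \sum_b eT a b * J a i' * J b j'.
    transitivity (\sum_a (\sum_b (\sum_al (- (J a i' * J b j' * d2h al a b)) * t y 0 al)
        + \sum_b eT a b * J a i' * J b j')).
      rewrite -sumrN; apply: eq_bigr => a _.
      rewrite -sumrN -big_split/=; apply: eq_bigr => b _.
      rewrite -!mulNr p2Tl !mulrDl; congr (_ + _).
      by rewrite !mulr_suml; apply: eq_bigr => al _; ring.
    rewrite big_split/=; congr (_ + _).
    under eq_bigr do rewrite exchange_big/=.
    rewrite exchange_big/=; apply: eq_bigr => al _.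
    rewrite /A -sumrN mulr_suml; apply: eq_bigr => a _.
    by rewrite -sumrN mulr_suml.
  have E2 : - (\sum_b partial (ellT y) b theta0 * H b i' j') =
      \sum_al (- B al i' j') * t y 0 al + \sum_b (\sum_al F al * dh al b) * H b i' j'.
    transitivity (\sum_b ((\sum_al (- (H b i' j' * dh al b)) * t y 0 al)
        + (\sum_al F al * dh al b) * H b i' j')).
      rewrite -sumrN; apply: eq_bigr => b _.
      rewrite -mulNr pT -sumrN !mulr_suml -big_split/=; apply: eq_bigr => al _.
      by ring.
    rewrite big_split/= exchange_big/=; congr (_ + _); apply: eq_bigr => al _.
    by rewrite /B -sumrN mulr_suml.
  rewrite p2X opprD E1 E2 /eX addrACA -big_split/=; congr (_ + _).
  by apply: eq_bigr => al _; ring.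
have covT a b c d : covariance P (Ihat2 Ys ellT theta0 a b) (Ihat2 Ys ellT theta0 c d) =
    (\sum_al \sum_be (- d2h al a b) * (- d2h be c d) * V al be)%:E.
  by rewrite !I2T (covariance_bilinear P _ _ _ _ T T).
rewrite !I2X (covariance_bilinear P _ _ _ _ T T)//.
have -> : (\sum_a \sum_b \sum_c \sum_d (J a i * J b j * J c k * J d l)%:E *
    covariance P (Ihat2 Ys ellT theta0 a b) (Ihat2 Ys ellT theta0 c d) =
    (\sum_a \sum_b \sum_c \sum_d (J a i * J b j) * (J c k * J d l) *
      \sum_al \sum_be (- d2h al a b) * (- d2h be c d) * V al be)%:E)%E.
  rewrite -sumEFin; apply: eq_bigr => a _; rewrite -sumEFin; apply: eq_bigr => b _.
  rewrite -sumEFin; apply: eq_bigr => c _; rewrite -sumEFin; apply: eq_bigr => d _.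
  by rewrite covT -EFinM !mulrA.
(* The Jacobians meet the second derivatives of [hL], so the transformed [theta] covariance becomes
   the form [V] with coefficients [A * A]. *)
rewrite (sum_bilinear2 (fun a b => J a i * J b j) (fun c d => J c k * J d l)
  (fun a b al => - d2h al a b)).
have -> : (\sum_al \sum_be (N%:R^-1 * C al be)%:E * fisherI nu t h0 al be =
    (\sum_al \sum_be C al be * V al be)%:E)%E.
  rewrite -sumEFin; apply: eq_bigr => al _; rewrite -sumEFin; apply: eq_bigr => be _.
  rewrite VE mulrCA mulrA [RHS]EFinM fineK//.
  exact: (fisherI_fin_num nu t ht h0 hint P Ys').
rewrite -EFinD; congr EFin; rewrite -[RHS]big_split/=; apply: eq_bigr => al _.
rewrite -[RHS]big_split/=; apply: eq_bigr => be _.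
have AN a i' j' : \sum_a0 \sum_b J a0 i' * J b j' * - d2h a a0 b = - A a i' j'.
  rewrite /A -sumrN; apply: eq_bigr => a0 _.
  by rewrite -sumrN; apply: eq_bigr => b _; rewrite mulrN.
(* [C] is what remains of the product of the two factors [A + B] once the term [A * A] is
   removed. *)
have CE : C al be = A al i j * B be k l + B al i j * A be k l + B al i j * B be k l.
  rewrite /C; congr (_ + _ + _).
  - rewrite /A /B mulr_suml; apply: eq_bigr => a _.
    by rewrite big_distrlr/=; apply: eq_bigr => b _; apply: eq_bigr => c _; ring.
  - rewrite /A /B mulr_suml; apply: eq_bigr => a _.
    rewrite mulr_sumr; apply: eq_bigr => b _.
    by rewrite mulr_sumr; apply: eq_bigr => c _; ring.
  - by rewrite /B big_distrlr/=; apply: eq_bigr => a _; apply: eq_bigr => b _; ring.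
by rewrite !AN CE -/(V al be); ring.
Qed.
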